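(* For any $\lambda\in(0.8\gamma^{-1},\gamma^{-1})$ and any $\varepsilon>0$, if the accuracy parameter is set to $$\eta=\frac{\varepsilon^2\lambda(1-\gamma\lambda)}{32\beta_{\mathcal X}^2},$$ then the primal-dual smoothing framework (Algorithm 1, described in the context) returns an $\varepsilon$-near-stationary point of $\min_{x\in\mathbb X}q(x)$ in no more than $\bar K$ iterations, where $$\bar K:=\left\lceil\frac{32\beta_{\mathcal X}^2\,(q(x_1)-q^* )}{5\varepsilon^2\lambda(\gamma\lambda-0.8)}\right\rceil+1.$$
   Context: Problem. $\mathbb X,\mathbb Y$ are finite-dimensional real normed spaces (norms $\|\cdot\|$, dual norms $\|\cdot\|_*$). $r:\mathbb X\to\mathbb R\cup\{+\infty\}$ is closed and convex with $\mathcal X:=\operatorname{dom} r$ nonempty, closed, convex. $\mathcal Y\subseteq\mathbb Y$ is nonempty, convex and compact; $g:\mathcal Y\to\mathbb R$ is convex and continuous. $\mathcal X'\supseteq\mathcal X$, $\mathcal Y'\supseteq\mathcal Y$ are open; $\Phi:\mathcal X'\times\mathcal Y'\to\mathbb R$ is jointly continuous and $\Phi(x,\cdot)$ is concave on $\mathcal Y$ for each $x\in\mathcal X$. Let $f(x):=\max_{y\in\mathcal Y}\Phi(x,y)-g(y)$, $q:=f+r$ (equal to $+\infty$ off $\mathcal X$), $q^*:=\min_{x\in\mathbb X}q(x)$, assumed $>-\infty$. Assumptions: (1) for $y\in\mathcal Y$, $\Phi(\cdot,y)$ is differentiable on $\mathcal X'$ and for $x,x'\in\mathcal X$, $y,y'\in\mathcal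 Y$: $\|\nabla_x\Phi(x,y)-\nabla_x\Phi(x',y)\|_*\le L_{xx}\|x-x'\|$, $\|\nabla_x\Phi(x,y)-\nabla_x\Phi(x,y')\|_*\le L_{xy}\|y-y'\|$. (2) For some $\gamma\in(0,L_{xx}]$, for all $y\in\mathcal Y$, $x,x'\in\mathcal X$: $\Phi(x',y)-\Phi(x,y)-\langle\nabla_x\Phi(x,y),x'-x\rangle\ge-(\gamma/2)\|x'-x\|^2$. (3) For $x\in\mathcal X$, $\Phi(x,\cdot)$ is differentiable on $\mathcal Y'$ and for $x,x'\in\mathcal X$, $y,y'\in\mathcal Y$: $\|\nabla_y\Phi(x,y)-\nabla_y\Phi(x',y)\|_*\le L_{xy}\|x-x'\|$, $\|\nabla_y\Phi(x,y)-\nabla_y\Phi(x,y')\|_*\le L_{yy}\|y-y'\|$. Distance generating functions (DGF). For a nonempty closed convex set $\mathcal U$ in a finite-dimensional normed space $\mathbb U$, $\omega_{\mathcal U}:\mathbb U\to\mathbb R\cup\{+\infty\}$ is a DGF on $\mathcal U$ if it is continuous and 1-strongly convex on $\mathcal U$ and essentially smooth (continuously differentiable on $\operatorname{int}\operatorname{dom}\omega_{\mathcal U}$, with $\|\nabla\omega_{\mathcal U}(u_k)\|_*\to+\infty$ whenever $u_k\in\operatorname{int}\operatorname{dom}\omega_{\mathcal U}$ converges to a boundary point of $\operatorname{dom}\omega_{\mathcal U}$). $D_{\omega_{\mathcal U}}(u',u):=\omega_{\mathcal U}(u')-\omega_{\mathcal U}(u)-\langle\nabla\omega_{\mathcal U}(u),u'-u\rangle$.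 $\omega_{\mathcal X}$ is a DGF on $\mathcal X$ that is twice continuously differentiable on $\operatorname{int}\operatorname{dom}\omega_{\mathcal X}$, with $\mathcal X\subseteq\operatorname{int}\operatorname{dom}\omega_{\mathcal X}$ and $\nabla\omega_{\mathcal X}$ $\beta_{\mathcal X}$-Lipschitz on $\mathcal X$, $\beta_{\mathcal X}\in[1,\infty)$. $\omega_{\mathcal Y}$ is a DGF on $\mathcal Y$, and $R_{\mathcal Y}(\omega_{\mathcal Y}):=\sup_{y\in\mathcal Y}|\omega_{\mathcal Y}(y)|<\infty$ (positive, as implicit in the choice of $\rho$ below). Smoothing. For $\rho>0$: $f_\rho(x):=\max_{y\in\mathcal Y}\Phi(x,y)-g(y)-\rho\,\omega_{\mathcal Y}(y)$ and $q_\rho:=f_\rho+r$. For $0<\lambda<\gamma^{-1}$, $x\in\mathcal X$: $\operatorname{prox}(q,x,\lambda):=\arg\min_{x'\in\mathbb X}q(x')+\lambda^{-1}D_{\omega_{\mathcal X}}(x',x)$ (unique), $Q_\rho^\lambda(x';x):=q_\rho(x')+\lambda^{-1}D_{\omega_{\mathcal X}}(x',x)$, $q_\rho^\lambda(x):=\min_{x'\in\mathbb X}Q_\rho^\lambda(x';x)$. A point $x\in\mathcal X$ is $\varepsilon$-near-stationary if for some $0<\lambda<\gamma^{-1}$, $\|\lambda^{-1}(x-\operatorname{prox}(q,x,\lambda))\|\le\varepsilon/\beta_{\mathcal X}$. Algorithm 1. Input: $\eta>0$, $\lambda\in(0,\gamma^{-1})$, $\rho:=2\eta/R_{\mathcal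 Y}(\omega_{\mathcal Y})$, $x_1\in\mathcal X$. For $k=1,2,\ldots$: find any $x_{k+1}\in\mathcal X$ with $Q_\rho^\lambda(x_{k+1};x_k)\le q_\rho^\lambda(x_k)+\eta$; terminate at the first $k$ for which $\|x_{k+1}-x_k\|\le\sqrt{2\eta/(\lambda^{-1}-\gamma)}$; with $K$ denoting this $k$ (the number of iterations), output $x_K$. *)

(* Defs.v *)
From HB Require Import structures.
From mathcomp Require Import all_boot all_order all_algebra.
From mathcomp Require Import all_classical all_reals all_analysis.

Set Implicit Arguments.
Unset Strict Implicit.
Unset Printing Implicit Defensive.

Import Order.TTheory GRing.Theory Num.Theory.
Import numFieldNormedType.Exports.

Local Open Scope classical_set_scope.
Local Open Scope ring_scope.

(* Finite-dimensional normed spaces. *)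
#[short(type="finNormedModType")]
HB.structure Definition FinNormedModule (K : numFieldType) :=
  {V of NormedModule K V & Vector K V}.

Section ExtendedFunctions.
Context {R : realType} {V : finNormedModType R}.
Implicit Types (h : V -> \bar R) (U : set V).

Definition edom h : set V := [set x | h x < +oo]%E.

(* h takes its values in R u {+oo}. *)
Definition never_ninfty h := forall x, h x != -oo%E.

(* The convention 0 * +oo = 0 makes the cases t = 0 and t = 1 trivial. *)
Definition econvex h := forall (x y : V) (t : R), 0 <= t <= 1 ->
  (h (t *: x + (1 - t) *: y)%R <= t%:E * h x + (1 - t)%:E * h y)%E.

Definition eclosed h := closed [set p : V * R | (h p.1 <= p.2%:E)%E].

Definition strongly_convex_on U h (mu : R) :=
  forall (x y : V) (t : R), U x -> U y -> 0 <= t <= 1 ->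
  (h (t *: x + (1 - t) *: y)%R <=
    t%:E * h x + (1 - t)%:E * h y
    - (mu / 2 * (t * (1 - t)) * `|x - y| ^+ 2)%:E)%E.

End ExtendedFunctions.

Section Gradients.
Context {R : realType} {V : finNormedModType R}.
Implicit Types (l f : V -> R) (U : set V).

(* A gradient is represented by the differential: <grad f x, v> = 'd f x v.
   The dual norm is valued in \bar R, and is finite on linear forms. *)
Definition dual_norm l : \bar R :=
  ereal_sup [set (`|l v|)%:E | v in [set v : V | `|v| <= 1]].

Definition grad f (x : V) : V -> R := 'd f x.

(* f is continuously differentiable on U (intended for open U). *)
Definition C1_on U f := forall u, U u ->
  differentiable f u /\
  dual_norm (grad f v \- grad f u) @[v --> u] --> 0%E.

(* As V is finite-dimensional, u |-> grad f u is continuously differentiable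
   if and only if all its evaluations u |-> <grad f u, v> are. *)
Definition C2_on U f :=
  C1_on U f /\ forall v : V, C1_on U (fun u => grad f u v).

End Gradients.

Section DistanceGenerating.
Context {R : realType} {V : finNormedModType R}.
Implicit Types (w : V -> \bar R) (U : set V).

(* w is real-valued on its domain, where fine is the identity. *)
Definition egrad w (u : V) : V -> R := grad (fine \o w) u.

Definition essentially_smooth w :=
  C1_on (edom w)° (fine \o w) /\
  forall (u : nat -> V) (b : V), (forall k, (edom w)° (u k)) ->
    u k @[k --> \oo] --> b -> (closure (edom w) `\` (edom w)°) b ->
    dual_norm (egrad w (u k)) @[k --> \oo] --> +oo%E.

Definition DGF U w :=
  [/\ never_ninfty w, {within U, continuous w},
      strongly_convex_on U w 1 & essentially_smooth w].

Definition bregman w (u' u : V) : \bar R :=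
  (w u' - w u - (egrad w u (u' - u)%R)%:E)%E.

Definition prox (h w : V -> \bar R) (x : V) (lam : R) : set V :=
  [set p | forall x' : V,
    (h p + lam^-1%:E * bregman w p x <= h x' + lam^-1%:E * bregman w x' x)%E].

(* "prox = [set p]" says that p is the unique minimizer. *)
Definition near_stationary (U : set V) (h w : V -> \bar R)
    (gamma beta eps : R) (x : V) :=
  U x /\ exists (lam : R) (p : V),
    [/\ 0 < lam < gamma^-1, prox h w x lam = [set p]
      & `|lam^-1 *: (x - p)| <= eps / beta].

End DistanceGenerating.

Section MaxStructured.
Context {R : realType} {X Y : finNormedModType R}.
Variables (r : X -> \bar R) (Ys : set Y) (g : Y -> R) (Phi : X -> Y -> R).
Variables (wX : X -> \bar R) (wY : Y -> \bar R).

(* The sets Xo, Yo are the open supersets of edom r and Ys; only the values of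
   Phi on Xo `*` Yo and of g on Ys matter. *)
Definition smooth_in_x (Xo : set X) (Lxx Lxy : R) :=
  [/\ forall x y, Xo x -> Ys y -> differentiable (Phi ^~ y) x,
      forall x x' y, edom r x -> edom r x' -> Ys y ->
        (dual_norm (grad (Phi ^~ y) x \- grad (Phi ^~ y) x')%R <=
          (Lxx * `|x - x'|)%:E)%E
    & forall x y y', edom r x -> Ys y -> Ys y' ->
        (dual_norm (grad (Phi ^~ y) x \- grad (Phi ^~ y') x)%R <=
          (Lxy * `|y - y'|)%:E)%E].

Definition weakly_convex_in_x (gamma : R) :=
  forall x x' y, edom r x -> edom r x' -> Ys y ->
    Phi x' y - Phi x y - grad (Phi ^~ y) x (x' - x) >=
      - (gamma / 2) * `|x' - x| ^+ 2.

Definition smooth_in_y (Yo : set Y) (Lxy Lyy : R) :=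
  [/\ forall x y, edom r x -> Yo y -> differentiable (Phi x) y,
      forall x x' y, edom r x -> edom r x' -> Ys y ->
        (dual_norm (grad (Phi x) y \- grad (Phi x') y)%R <=
          (Lxy * `|x - x'|)%:E)%E
    & forall x y y', edom r x -> Ys y -> Ys y' ->
        (dual_norm (grad (Phi x) y \- grad (Phi x) y')%R <=
          (Lyy * `|y - y'|)%:E)%E].

(* Maxima and minima of values are written as suprema and infima in \bar R. *)
Definition f_max (x : X) : \bar R :=
  ereal_sup [set (Phi x y - g y)%:E | y in Ys].

Definition q_obj (x : X) : \bar R := (f_max x + r x)%E.

Definition q_star : \bar R := ereal_inf (range q_obj).

Definition DGF_radius : \bar R := ereal_sup [set `|wY y|%E | y in Ys].

Definition f_smooth (rho : R) (x : X) : \bar R :=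
  ereal_sup [set ((Phi x y - g y)%:E - rho%:E * wY y)%E | y in Ys].

Definition q_smooth (rho : R) (x : X) : \bar R := (f_smooth rho x + r x)%E.

Definition Q_smooth (rho lam : R) (x' x : X) : \bar R :=
  (q_smooth rho x' + lam^-1%:E * bregman wX x' x)%E.

Definition q_env (rho lam : R) (x : X) : \bar R :=
  ereal_inf (range (Q_smooth rho lam ^~ x)).

Definition stops (gamma eta lam : R) (x : nat -> X) (k : nat) :=
  `|x k.+1 - x k| <= Num.sqrt (2 * eta / (lam^-1 - gamma)).

(* The iterates are numbered from 1 and x 0 is unused.  Step k is performed
   only if no earlier step stopped, so x is unconstrained after termination;
   the choice of x k.+1 is otherwise arbitrary. *)
Definition pds_run (gamma eta lam : R) (x1 : X) (x : nat -> X) :=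
  let rho := 2 * eta / fine DGF_radius in
  x 1%N = x1 /\
  forall k, (1 <= k)%N ->
    (forall j, (1 <= j < k)%N -> ~ stops gamma eta lam x j) ->
    edom r (x k.+1) /\
    (Q_smooth rho lam (x k.+1) (x k) <= q_env rho lam (x k) + eta%:E)%E.

Definition terminates_at (gamma eta lam : R) (x : nat -> X) (K : nat) :=
  [/\ (1 <= K)%N, stops gamma eta lam x K
    & forall j, (1 <= j < K)%N -> ~ stops gamma eta lam x j].

End MaxStructured.

(* Main.v *)
Require Import Defs.
From HB Require Import structures.
From mathcomp Require Import all_boot all_order all_algebra.
From mathcomp Require Import all_classical all_reals all_analysis.
From mathcomp Require Import ring lra.
Import Order.TTheory GRing.Theory Num.Theory.
Import numFieldNormedType.Exports VectorInternalTheory.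
Local Open Scope classical_set_scope.
Local Open Scope ring_scope.

(** Write mu = 1/lam - gamma, D for the Bregman distance of wX, and let eta be
    the accuracy.  Since rho times the radius of wY equals 2 * eta, the smoothed
    objective q_rho differs from q by at most 2 * eta on dom r, and the smoothing
    enters through this estimate.

    Near-stationarity.  The function q + D(., x) / lam is mu-strongly convex on
    dom r: q is a supremum of gamma-weakly convex functions plus a convex one,
    and D(., x) is 1-strongly convex.  It is bounded below because q_star is
    finite, so it has a unique minimizer p, around which it grows like
    (mu / 2) * |z - p|^2 ([prox_growth]).  An eta-minimizer of the smoothed
    subproblem is a 5 * eta-minimizer of this function (eta, plus 2 * eta for
    each of the two changes of objective), so that |x_(K+1) - p| <= sqrt 5 * s
    with s = sqrt (2 * eta / mu).  The stopping test says |x_(K+1) - x_K| <= s;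
    hence |x_K - p| <= 4 * s, and eta is chosen so that s = eps * lam / (4 *
    betaX) ([stopping_radius]).

    Iteration count.  Put a = gamma * lam and c = eps^2 * lam / (32 * betaX^2),
    so that eta = c * (1 - a).  Comparing x_(k+1) with x_k in the subproblem
    bounds D(x_(k+1), x_k) / lam by the decrease of q_rho plus eta.  If the test
    fails then |x_(k+1) - x_k| > s and D(u, v) >= |u - v|^2 / 2 make the left
    side at least c, so q_rho decreases by at least c - eta = a * c.  As q_rho
    starts below q x1 + 2 * eta and stays above q_star - 2 * eta, n failures
    give n * (a * c) <= q x1 - q_star + 4 * (1 - a) * c.  For n >= 1 the last
    term is at most n times itself, which can be moved to the left:
    n * (5 * a - 4) * c <= q x1 - q_star ([iteration_count]).  This is where the
    condition a > 4 / 5 comes from. *)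

Set Implicit Arguments.
Unset Strict Implicit.
Unset Printing Implicit Defensive.

(** * Completeness of finite-dimensional normed spaces *)

Section FiniteDimension.
Context {R : realType} {V : finNormedModType R}.

Local Notation n := (dim V).
Local Notation r2v := (@r2v R V).
Local Notation v2r := (@v2r R V).

Lemma r2v_continuous : continuous (r2v : 'rV[R]_n -> V).
Proof.
apply: (@bounded_linear_continuous R 'rV[R]_n V r2v); apply/linear_boundedP.
exists (\sum_(i < n) `|r2v (delta_mx 0 i)|); split=> [|M /ltW SM a].
  exact: num_real.
apply: (@le_trans _ _ ((\sum_(i < n) `|r2v (delta_mx 0 i)|) * `|a|)); last first.
  exact: ler_wpM2r.
rewrite {1}(row_sum_delta a) linear_sum mulr_suml.
apply: (le_trans (ler_norm_sum _ _ _)); apply: ler_sum => i _.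
rewrite linearZ normrZ mulrC ler_wpM2l //.
rewrite [leRHS]/Num.norm /= mx_normrE.
by apply/bigmax_geP; right; exists (ord0, i).
Qed.

(** The norm of V, pulled back to coordinates, is continuous and positive on the
    compact unit sphere, so it has a positive minimum there; homogeneity does
    the rest. *)
Lemma v2r_bounded : exists2 C : R, 0 < C &
  forall v : V, `|(v2r v : 'rV[R]_n)| <= C * `|v|.
Proof.
pose S := [set a : 'rV[R]_n | `|a| = 1].
have cr : continuous (fun a : 'rV[R]_n => `|r2v a|).
  move=> a; apply: (@continuous_comp _ _ _ r2v Num.norm).
    exact: r2v_continuous.
  exact: norm_continuous.
have cS : compact S.
  apply: bounded_closed_compact.
    by exists 1; split => // M M1 a /= ->; exact: ltW.
  have /continuous_closedP := @norm_continuous R 'rV[R]_n.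
  by move=> h; apply: (h [set t : R | t = 1]); exact: closed_eq.
(* The sphere is empty exactly when the space is trivial. *)
have [S0|/set0P S0] := eqVneq S set0.
  exists 1 => // v; suff -> : v2r v = 0 by rewrite normr0 mul1r.
  apply/eqP/negPn/negP => v0.
  have : S (`|v2r v|^-1 *: v2r v).
    by rewrite /S /= normrZ normfV normr_id mulVf // normr_eq0.
  by rewrite S0.
have [c cS' hc] := EVT_min_rV S0 cS (continuous_subspaceT cr).
have c1 : `|c| = 1 by move: cS'; rewrite inE.
have c0 : 0 < `|r2v c|.
  rewrite normr_gt0; apply/eqP => rc0.
  have cz : c = 0 by apply: r2v_inj; rewrite rc0 linear0.
  by move: c1; rewrite cz normr0 => /esym/eqP; rewrite oner_eq0.
exists (`|r2v c|^-1); first by rewrite invr_gt0.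
move=> v; have [->|v0] := eqVneq v 0; first by rewrite linear0 !normr0 mulr0.
have a0 : 0 < `|v2r v|.
  rewrite normr_gt0; apply: contra_neq v0 => h.
  by apply: v2r_inj; rewrite h linear0.
rewrite mulrC ler_pdivlMr // -ler_pdivlMl //.
have := hc (`|v2r v|^-1 *: v2r v); rewrite inE /S /=.
rewrite normrZ normfV normr_id mulVf ?gt_eqF // => /(_ erefl).
by rewrite linearZ /= v2rK normrZ normfV normr_id.
Qed.

(** The coordinates of a Cauchy sequence form a Cauchy sequence of row vectors,
    whose limit is carried back by the continuous map r2v. *)
Lemma fin_cauchy_cvg (u : nat -> V) :
  (forall e : R, 0 < e -> \forall i & j \near \oo, `|u i - u j| <= e) ->
  cvg (u @ \oo).
Proof.
move=> cu; have [C C0 hC] := v2r_bounded.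
have /cauchy_cvgP/cvg_ex[a au] : cauchy ((fun i => v2r (u i) : 'rV[R]_n) @ \oo).
  apply/cauchy_ballP => e e0.
  have e2 : 0 < e / 2 / C by rewrite !divr_gt0.
  rewrite near_map2; apply: filterS (cu _ e2) => -[i j] /= hij.
  rewrite -ball_normE /= -linearB (le_lt_trans (hC _)) //.
  apply: (@le_lt_trans _ _ (e / 2)); last by lra.
  by rewrite mulrC -ler_pdivlMr.
apply/cvg_ex; exists (r2v a).
have -> : u = r2v \o (fun i => v2r (u i)).
  by apply/funext => i /=; rewrite v2rK.
by apply: (cvg_comp _ _ au); apply: r2v_continuous.
Qed.
End FiniteDimension.

(** * Functions with a modulus of convexity *)

Section StrongConvexity.
Context {R : realType} {V : finNormedModType R}.
Implicit Types (U : set V) (h : V -> R).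

(** Convexity with a real weight, the form in which [econvex] and
    [strongly_convex_on] use it. *)
Definition line_convex U := forall (x y : V) (t : R),
  U x -> U y -> 0 <= t <= 1 -> U (t *: x + (1 - t) *: y).

(** One notion covers strongly convex (mu > 0), convex (mu = 0) and weakly
    convex (mu < 0) functions, so that moduli simply add up when functions do. *)
Definition convex_mod U h (mu : R) := forall (x y : V) (t : R),
  U x -> U y -> 0 <= t <= 1 ->
  h (t *: x + (1 - t) *: y) <=
    t * h x + (1 - t) * h y - mu / 2 * (t * (1 - t)) * `|x - y| ^+ 2.

Lemma cvg_mul1B (a : R) : a * (1 - t) @[t --> 0^'+] --> a.
Proof.
rewrite -[X in _ --> X]mulr1 -[X in _ * X](subr0 (1 : R)).
apply: (@cvg_at_right_filter _ _ (fun t : R => a * (1 - t))); apply: cvgMl_tmp.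
by apply: cvgB; [exact: cvg_cst|exact: cvg_id].
Qed.

(** Divide the convexity inequality on the segment from x to y by the weight t
    of y, and let t tend to 0 from the right. *)
Lemma convex_mod_gradient U h mu x y :
  convex_mod U h mu -> U x -> U y -> differentiable h x ->
  mu / 2 * `|y - x| ^+ 2 <= h y - h x - grad h x (y - x).
Proof.
move=> hU Ux Uy dh; rewrite /grad -deriveE //.
have cl : (fun t : R => t^-1 *: (h (t *: (y - x) + x) - h x)) @ 0^'+ -->
    'D_(y - x) h x.
  by apply: cvg_dnbhs_at_right; exact: diff_derivable.
have cr : (fun t : R => h y - h x - mu / 2 * `|y - x| ^+ 2 * (1 - t)) @ 0^'+
    --> h y - h x - mu / 2 * `|y - x| ^+ 2.
  by apply: cvgB; [exact: cvg_cst|exact: cvg_mul1B].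
suff : 'D_(y - x) h x <= h y - h x - mu / 2 * `|y - x| ^+ 2 by lra.
apply: (ler_cvg_to cl cr); near=> t.
have t0 : 0 < t by [].
have t1 : t <= 1 by near: t; exact: nbhs_right_le.
rewrite /= -[_ *: (_ - h x)]/(t^-1 * (h (t *: (y - x) + x) - h x)).
rewrite mulrC ler_pdivrMr //.
have -> : t *: (y - x) + x = t *: y + (1 - t) *: x.
  by rewrite scalerBr scalerBl scale1r -addrA [- _ + _]addrC.
have := hU y x t Uy Ux; rewrite (ltW t0) t1 => /(_ erefl); lra.
Unshelve. all: by end_near. Qed.

(** Average the gradient inequalities from z = t x + (1 - t) y towards x and
    towards y with weights t and 1 - t.  The gradient terms cancel and the
    quadratic ones add up, since t (1 - t)^2 + (1 - t) t^2 = t (1 - t). *)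
Lemma convex_mod_of_gradient U h mu :
  line_convex U -> (forall x, U x -> differentiable h x) ->
  (forall x y, U x -> U y ->
    mu / 2 * `|y - x| ^+ 2 <= h y - h x - grad h x (y - x)) ->
  convex_mod U h mu.
Proof.
move=> cU dh hU x y t Ux Uy t01; have Uz := cU _ _ _ Ux Uy t01.
move/andP: t01 => [t0 t1].
set z := _ + _ in Uz *.
have zE : z = y + t *: (x - y) by rewrite /z scalerBl scale1r scalerBr addrCA.
have xz : x - z = (1 - t) *: (x - y) by rewrite zE opprD addrA scalerBl scale1r.
have yz : y - z = (- t) *: (x - y).
  by rewrite zE opprD addrA subrr add0r scaleNr.
have gZ a : grad h z (a *: (x - y)) = a * grad h z (x - y).
  by rewrite /grad linearZ.
have := hU z x Uz Ux; have := hU z y Uz Uy.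
rewrite xz yz !gZ !normrZ normrN (ger0_norm t0) ger0_norm ?subr_ge0 //.
rewrite !exprMn => /(ler_wpM2l (_ : 0 <= 1 - t)); rewrite subr_ge0 => /(_ t1) h1.
by move=> /(ler_wpM2l t0) h2; lra.
Qed.

(** Two near-minimizers of a strongly convex function are close, because their
    midpoint cannot go below the lower bound m.  This makes minimizing sequences
    Cauchy. *)
Lemma convex_mod_gap U h mu m dx dy x y :
  0 < mu -> line_convex U -> convex_mod U h mu -> (forall z, U z -> m <= h z) ->
  U x -> U y -> h x <= m + dx -> h y <= m + dy ->
  mu * `|x - y| ^+ 2 <= 4 * (dx + dy).
Proof.
move=> mu0 cU hU hm Ux Uy hx hy.
have h01 : 0 <= (1 / 2 : R) <= 1 by lra.
have := hU x y _ Ux Uy h01; have := hm _ (cU _ _ _ Ux Uy h01); lra.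
Qed.

(** Compare p with the point of weight t on the segment from p to x, divide by t
    and let t tend to 0.  The midpoint alone would lose a factor 2. *)
Lemma convex_mod_growth U h mu p x :
  0 < mu -> line_convex U -> convex_mod U h mu -> U p ->
  (forall z, U z -> h p <= h z) -> U x ->
  mu / 2 * `|x - p| ^+ 2 <= h x - h p.
Proof.
move=> mu0 cU hU Up hm Ux.
apply: (cvgr_to_le (@cvg_mul1B _)).
near=> t.
have t0 : 0 < t by [].
have t1 : t <= 1 by near: t; exact: nbhs_right_le.
have t01 : 0 <= t <= 1 by rewrite (ltW t0).
rewrite /= -(ler_pM2l t0).
have := hU x p _ Ux Up t01; have := hm _ (cU _ _ _ Ux Up t01); lra.
Unshelve. all: by end_near. Qed.

(** A minimizing sequence is Cauchy by [convex_mod_gap], hence converges; closed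
    sublevel sets put the limit in U, with the infimum as value.  Strong
    convexity thus replaces compactness of U. *)
Lemma convex_mod_has_min U h mu m :
  0 < mu -> line_convex U -> convex_mod U h mu -> U !=set0 ->
  (forall z, U z -> m <= h z) ->
  (forall c, closed [set z | U z /\ h z <= c]) ->
  exists2 p, U p & forall z, U z -> h p <= h z.
Proof.
move=> mu0 cU hU [x0 Ux0] hm hcl.
pose S := h @` U.
have infS : has_inf S.
  by split; [exists (h x0), x0|exists m => _ [z Uz <-]; exact: hm].
have infP z : U z -> inf S <= h z by move=> Uz; apply: ge_inf; [case: infS|exists z].
have /choice[u hu] : forall k : nat, exists z, U z /\ h z <= inf S + k.+1%:R^-1.
  move=> k; have k0 : 0 < (k.+1%:R^-1 : R) by rewrite invr_gt0.
  by have [_ [z Uz <-] /ltW hz] := inf_adherent k0 infS; exists z.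
have invk (e : R) : 0 < e -> \forall k \near \oo, (k.+1%:R^-1 : R) <= e.
  move=> e0; have := @cvg_harmonic R; move/cvgr0_norm_le => /(_ _ e0).
  by apply: filterS => k; apply: le_trans; rewrite ler_norm.
have /cvg_ex[p up] : cvg (u @ \oo).
  apply: fin_cauchy_cvg => e e0.
  have e2 : 0 < mu * e ^+ 2 / 8 by rewrite divr_gt0 // mulr_gt0 // exprn_gt0.
  near=> i j.
  have hi : (i.+1%:R^-1 : R) <= mu * e ^+ 2 / 8 by near: i; exact: invk.
  have hj : (j.+1%:R^-1 : R) <= mu * e ^+ 2 / 8 by near: j; exact: invk.
  have [Ui ui] := hu i; have [Uj uj] := hu j.
  have gap := convex_mod_gap mu0 cU hU infP Ui Uj ui uj.
  have : mu * `|u i - u j| ^+ 2 <= mu * e ^+ 2.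
    by move: (i.+1%:R^-1) (j.+1%:R^-1) hi hj gap => a b; lra.
  by rewrite ler_pM2l // ler_pXn2r ?nnegrE // ltW.
have hp c : 0 < c -> U p /\ h p <= inf S + c.
  move=> c0; apply: (@closed_cvg _ _ \oo _ u
    [set z | U z /\ h z <= inf S + c]) up => //.
  apply: filterS (invk _ c0) => k hk; have [Uk uk] := hu k; split=> //.
  by apply: le_trans uk _; rewrite lerD2l.
exists p; first by have [] := hp 1 ltr01.
move=> z Uz; apply/ler_addgt0Pr => e e0.
by apply: le_trans (hp _ e0).2 _; rewrite lerD2r infP.
Unshelve. all: by end_near. Qed.
End StrongConvexity.

Section ConvexModulus.
Context {R : realType} {V : finNormedModType R}.
Implicit Types (U : set V) (h : V -> R) (w : V -> \bar R).

Lemma convex_modD U h1 h2 mu1 mu2 : convex_mod U h1 mu1 ->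
  convex_mod U h2 mu2 -> convex_mod U (fun z => h1 z + h2 z) (mu1 + mu2).
Proof.
move=> c1 c2 x y t Ux Uy t01.
by have := c1 x y t Ux Uy t01; have := c2 x y t Ux Uy t01; lra.
Qed.

Lemma convex_modZ U h mu a : 0 <= a -> convex_mod U h mu ->
  convex_mod U (fun z => a * h z) (a * mu).
Proof.
by move=> a0 ch x y t Ux Uy t01; have := ler_wpM2l a0 (ch x y t Ux Uy t01); lra.
Qed.

Lemma convex_mod_affine U (l : {linear V -> R^o}) (c : R) x0 :
  convex_mod U (fun z => c + l (z - x0)) 0.
Proof.
move=> x y t _ _ _.
have -> : t *: x + (1 - t) *: y - x0 = t *: (x - x0) + (1 - t) *: (y - x0).
  by rewrite !scalerBr addrACA -opprD -scalerDl [t + _]addrC subrK scale1r.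
have -> : l (t *: (x - x0) + (1 - t) *: (y - x0)) =
    t * l (x - x0) + (1 - t) * l (y - x0) :> R.
  by rewrite linearP linearZ.
by move: (l (x - x0) : R) (l (y - x0) : R) => a b; lra.
Qed.

(** The two middle hypotheses say that F is the pointwise supremum of the phi y;
    the modulus survives because the defect term does not depend on y. *)
Lemma convex_mod_sup (T : Type) (A : set T) (phi : T -> V -> R) U F mu :
  line_convex U ->
  (forall z y, U z -> A y -> phi y z <= F z) ->
  (forall z c, U z -> (forall y, A y -> phi y z <= c) -> F z <= c) ->
  (forall y, A y -> convex_mod U (phi y) mu) -> convex_mod U F mu.
Proof.
move=> cU ub lub cphi x x' t Ux Ux' t01; apply: lub; first exact: cU.
move=> y Ay; apply: (le_trans (cphi y Ay x x' t Ux Ux' t01)).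
case/andP: t01 => t0 t1.
rewrite lerD2r lerD // ler_wpM2l ?subr_ge0 // ub //.
Qed.

Lemma strongly_convex_on_fine U w mu : line_convex U ->
  (forall z, U z -> w z \is a fin_num) ->
  strongly_convex_on U w mu -> convex_mod U (fine \o w) mu.
Proof.
move=> cU wf sw x y t Ux Uy t01; have := sw x y t Ux Uy t01.
rewrite -(fineK (wf _ Ux)) -(fineK (wf _ Uy)) -(fineK (wf _ (cU _ _ _ Ux Uy t01))).
by rewrite -!EFinM -!EFinD lee_fin.
Qed.

Lemma econvex_line_convex w : never_ninfty w -> econvex w -> line_convex (edom w).
Proof.
move=> wN cw x y t xw yw t01; apply: (le_lt_trans (cw x y t t01)).
have wf z : edom w z -> w z \is a fin_num by move=> wz; rewrite fin_numE wN -ltey.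
by rewrite -(fineK (wf _ xw)) -(fineK (wf _ yw)) -!EFinM -EFinD ltry.
Qed.

Lemma econvex_fine w : never_ninfty w -> econvex w ->
  convex_mod (edom w) (fine \o w) 0.
Proof.
move=> wN cw; apply: strongly_convex_on_fine.
- exact: econvex_line_convex.
- by move=> z wz; rewrite fin_numE wN -ltey.
- by move=> x y t xw yw t01; rewrite !mul0r sube0; exact: cw.
Qed.

(** Sublevel sets of sup_y phi y + w + b.  For fixed y, membership places the
    point (z, c - phi y z - b z) in the closed epigraph of w, and this point
    depends continuously on z; taking the supremum over y comes last.  Thus w
    enters through its epigraph, phi y and b through their continuity. *)
Lemma composite_sublevel_closed (T : Type) (A : set T) (phi : T -> V -> R)
    (F b : V -> R) w (c : R) :
  never_ninfty w -> eclosed w -> closed (edom w) ->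
  (forall z y, edom w z -> A y -> phi y z <= F z) ->
  (forall z d, edom w z -> (forall y, A y -> phi y z <= d) -> F z <= d) ->
  (forall z y, edom w z -> A y -> {for z, continuous (phi y)}) ->
  (forall z, edom w z -> {for z, continuous b}) ->
  closed [set z | edom w z /\ F z + fine (w z) + b z <= c].
Proof.
move=> wN wcl dcl ub lub cphi cb p clp.
have wp : edom w p.
  by apply: dcl => B /clp[z [[wz _] Bz]]; exists z.
have wf z : edom w z -> w z \is a fin_num by move=> wz; rewrite fin_numE wN -ltey.
split => //.
suff : F p <= c - b p - fine (w p) by lra.
apply: lub => // y Ay.
suff : (w p <= (c - phi y p - b p)%:E)%E.
  by rewrite -[w p]fineK ?wf // lee_fin; lra.
have cont : (fun z => (z, c - phi y z - b z)) @ p --> (p, c - phi y p - b p).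
  apply: (@cvg_pair _ _ _ _ (nbhs p) (nbhs (c - phi y p - b p))).
    exact: cvg_id.
  apply: cvgB; last exact: cb.
  by apply: cvgB; [exact: cvg_cst|exact: cphi].
apply: (wcl (p, c - phi y p - b p)) => B /cont /clp[z [[wz hz] Bz]].
exists (z, c - phi y z - b z); split => //=.
rewrite -[w z]fineK ?wf // lee_fin; have := ub z y wz Ay; lra.
Qed.

End ConvexModulus.

(** * Bregman distances *)

Section Bregman.
Context {R : realType} {V : finNormedModType R}.
Variables (U : set V) (w : V -> \bar R).
Hypotheses (w_dgf : DGF U w) (w_int : U `<=` (edom w)°) (U_convex : line_convex U).

Lemma dgf_fin_num z : U z -> w z \is a fin_num.
Proof.
case: w_dgf => wN _ _ _ /w_int/interior_subset wz.
by rewrite fin_numE wN -ltey.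
Qed.

Lemma dgf_differentiable z : U z -> differentiable (fine \o w) z.
Proof. by case: w_dgf => _ _ _ [c1 _] /w_int/c1[]. Qed.

Lemma dgf_convex_mod : convex_mod U (fine \o w) 1.
Proof.
by case: w_dgf => _ _ sw _; apply: strongly_convex_on_fine => //; exact: dgf_fin_num.
Qed.

Lemma bregman_fin_num z x : U z -> U x -> bregman w z x \is a fin_num.
Proof. by move=> Uz Ux; rewrite /bregman !fin_numB !dgf_fin_num. Qed.

Lemma fine_bregmanE z x : U z -> U x -> fine (bregman w z x) =
  fine (w z) + (- fine (w x) - egrad w x (z - x)).
Proof.
move=> Uz Ux; rewrite /bregman -(fineK (dgf_fin_num Uz)) -(fineK (dgf_fin_num Ux)).
by rewrite -!EFinB /= addrA.
Qed.

Lemma bregman_neqNy z x : U x -> bregman w z x != -oo%E.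
Proof.
case: w_dgf => wN _ _ _ Ux; rewrite /bregman -(fineK (dgf_fin_num Ux)) -!EFinN.
by have := wN z; case: (w z).
Qed.

Lemma bregman_diag x : U x -> fine (bregman w x x) = 0.
Proof.
by move=> Ux; rewrite fine_bregmanE // subrr /egrad /grad linear0; lra.
Qed.

Lemma bregman_ge z x : U z -> U x -> `|z - x| ^+ 2 / 2 <= fine (bregman w z x).
Proof.
move=> Uz Ux; have := convex_mod_gradient dgf_convex_mod Ux Uz (dgf_differentiable Ux).
by rewrite fine_bregmanE // /egrad /=; lra.
Qed.

Lemma bregman_convex_mod x : U x -> convex_mod U (fun z => fine (bregman w z x)) 1.
Proof.
move=> Ux y z t Uy Uz t01; rewrite !fine_bregmanE //; last exact: U_convex.
have := convex_modD dgf_convex_mod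
  (@convex_mod_affine _ _ U (\- ('d (fine \o w) x)) (- fine (w x)) x).
move/(_ y z t Uy Uz t01); rewrite addr0 /=; exact.
Qed.

Lemma bregman_continuous x z : U x -> U z ->
  {for z, continuous (fun z => fine (w z) + (- fine (w x) - egrad w x (z - x)))}.
Proof.
move=> Ux Uz; apply: cvgD; first exact: (differentiable_continuous (dgf_differentiable Uz)).
apply: cvgB; first exact: cvg_cst.
apply: (@continuous_comp _ _ _ (fun z => z - x) (egrad w x)).
  by apply: cvgB; [exact: cvg_id|exact: cvg_cst].
exact: (diff_continuous (dgf_differentiable Ux)).
Qed.
End Bregman.

(** * The objective and its smoothing *)

Section ErealSup.
Context {R : realType} {T : Type}.
Implicit Types (A : set T) (phi : T -> R).

Lemma sup_fin_num A phi (M : R) : A !=set0 -> (forall y, A y -> phi y <= M) ->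
  ereal_sup [set (phi y)%:E | y in A] \is a fin_num.
Proof.
move=> [y0 Ay0] hM; rewrite fin_numElt; apply/andP; split.
  apply: (@lt_le_trans _ _ (phi y0)%:E); first exact: ltNyr.
  by apply: ereal_sup_ubound; exists y0.
apply: (@le_lt_trans _ _ M%:E); last exact: ltry.
by apply: ge_ereal_sup => _ [y Ay <-]; rewrite lee_fin hM.
Qed.
End ErealSup.

Section Objective.
Context {R : realType} {X Y : finNormedModType R}.
Variables (r : X -> \bar R) (Ys : set Y) (g : Y -> R) (Phi : X -> Y -> R).
Hypotheses (r_proper : never_ninfty r) (Ys_neq0 : Ys !=set0).

Local Notation f := (f_max Ys g Phi).
Local Notation q := (q_obj r Ys g Phi).

Lemma f_max_ubound x y : Ys y -> ((Phi x y - g y)%:E <= f x)%E.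
Proof. by move=> Yy; apply: ereal_sup_ubound; exists y. Qed.

Lemma f_max_neqNy x : f x != -oo%E.
Proof.
case: Ys_neq0 => y Yy; rewrite -ltNye.
by apply: lt_le_trans (f_max_ubound x Yy); exact: ltNyr.
Qed.

Lemma r_fin_num x : edom r x -> r x \is a fin_num.
Proof. by move=> rx; rewrite fin_numE r_proper -ltey. Qed.

Lemma q_obj_off x : ~ edom r x -> q x = +oo%E.
Proof.
move=> /negP; rewrite -leNgt leye_eq => /eqP rx; rewrite /q_obj rx addey //.
exact: f_max_neqNy.
Qed.

Hypotheses (Ys_compact : compact Ys) (g_cont : {within Ys, continuous g}).

Lemma f_max_fin_num x : (forall y, Ys y -> differentiable (Phi x) y) ->
  f x \is a fin_num.
Proof.
move=> dPhi.
have cphi : {within Ys, continuous (fun y => Phi x y - g y)}.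
  move=> y; apply: (@cvgB _ _ _ _ _ (Phi x : subspace Ys -> R) g); last exact: g_cont.
  move: y; apply: continuous_in_subspaceT => y; rewrite inE => Yy.
  exact/differentiable_continuous/dPhi.
have [c Yc hc] := compact_EVT_max Ys_neq0 Ys_compact cphi.
apply: (@sup_fin_num _ _ _ _ (Phi x c - g c)) => // y Yy.
by apply: hc; rewrite inE.
Qed.

Section Smoothed.
Variables (wY : Y -> \bar R) (rho : R).
Hypotheses (rho_ge0 : 0 <= rho) (radius_fin : (DGF_radius Ys wY < +oo)%E).
Local Notation M := (fine (DGF_radius Ys wY)).

Lemma radiusP y : Ys y -> exists2 w : R, wY y = w%:E & `|w| <= M.
Proof.
move=> Yy; have hy : (`|wY y| <= DGF_radius Ys wY)%E by apply: ereal_sup_ubound; exists y.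
have rf : DGF_radius Ys wY \is a fin_num.
  by rewrite ge0_fin_numE // (le_trans _ hy).
have wf : wY y \is a fin_num by rewrite -abse_fin_num ge0_fin_numE // (le_lt_trans hy).
exists (fine (wY y)); first by rewrite fineK.
by rewrite -fine_abse // fine_le // abse_fin_num.
Qed.

Lemma f_smooth_le x : (f_smooth Ys g Phi wY rho x <= f x + (rho * M)%:E)%E.
Proof.
apply: ge_ereal_sup => _ [y Yy <-]; have [w -> wM] := radiusP Yy.
apply: (@le_trans _ _ ((Phi x y - g y)%:E + (rho * M)%:E)%E); last first.
  by rewrite leeD2r // f_max_ubound.
rewrite -EFinM -EFinB -EFinD lee_fin -mulrN lerD2l ler_wpM2l //.
by rewrite (le_trans _ wM) // -normrN ler_norm.
Qed.

Lemma f_smooth_ge x : (f x <= f_smooth Ys g Phi wY rho x + (rho * M)%:E)%E.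
Proof.
apply: ge_ereal_sup => _ [y Yy <-]; have [w wE wM] := radiusP Yy.
apply: (@le_trans _ _ ((Phi x y - g y)%:E - rho%:E * wY y + (rho * M)%:E)%E); last first.
  by rewrite leeD2r //; apply: ereal_sup_ubound; exists y.
rewrite wE -EFinM -EFinB -EFinD lee_fin -addrA lerDl addrC subr_ge0.
by rewrite ler_wpM2l // (le_trans _ wM) // ler_norm.
Qed.

Section Finite.
Variable x : X.
Hypotheses (rx : edom r x) (fx : f x \is a fin_num).

Lemma f_smooth_fin_num : f_smooth Ys g Phi wY rho x \is a fin_num.
Proof.
by move: (f_smooth_le x) (f_smooth_ge x); rewrite -(fineK fx); case: (f_smooth _ _ _ _ _ _).
Qed.

Lemma q_smooth_fin_num : q_smooth r Ys g Phi wY rho x \is a fin_num.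
Proof. by rewrite fin_numD f_smooth_fin_num r_fin_num. Qed.

(** Smoothing perturbs every payoff in the supremum by at most rho times the
    radius, hence also the supremum. *)
Lemma q_smooth_near : fine (q x) - rho * M <=
  fine (q_smooth r Ys g Phi wY rho x) <= fine (q x) + rho * M.
Proof.
rewrite /q_obj /q_smooth !fineD ?f_smooth_fin_num ?r_fin_num //.
move: (f_smooth_le x) (f_smooth_ge x).
rewrite -(fineK fx) -(fineK f_smooth_fin_num) -!EFinD !lee_fin /= => h1 h2.
by apply/andP; split; lra.
Qed.
End Finite.

End Smoothed.
End Objective.

(** * The proximal point *)

Section Prox.
Context {R : realType} {X Y : finNormedModType R}.
Variables (r : X -> \bar R) (Ys : set Y) (g : Y -> R) (Phi : X -> Y -> R).
Variables (wX : X -> \bar R) (gamma : R).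
Hypotheses (r_proper : never_ninfty r) (r_closed : eclosed r)
  (r_convex : econvex r) (domr_closed : closed (edom r)) (Ys_neq0 : Ys !=set0)
  (f_fin : forall x, edom r x -> f_max Ys g Phi x \is a fin_num)
  (Phi_diff : forall x y, edom r x -> Ys y -> differentiable (Phi ^~ y) x)
  (Phi_weakly_convex : weakly_convex_in_x r Ys Phi gamma)
  (q_star_gt : (-oo < q_star r Ys g Phi)%E)
  (wX_dgf : DGF (edom r) wX) (wX_int : edom r `<=` (edom wX)°).

Local Notation U := (edom r).
Local Notation f := (f_max Ys g Phi).
Local Notation q := (q_obj r Ys g Phi).

Let U_convex : line_convex U := econvex_line_convex r_proper r_convex.

Lemma q_obj_fin_num x : U x -> q x \is a fin_num.
Proof. by move=> Ux; rewrite fin_numD f_fin // r_fin_num. Qed.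

Lemma fine_q_objE x : U x -> fine (q x) = fine (f x) + fine (r x).
Proof. by move=> Ux; rewrite /q_obj fineD ?f_fin ?r_fin_num. Qed.

Lemma q_star_fin_num x : U x -> q_star r Ys g Phi \is a fin_num.
Proof.
move=> Ux; rewrite fin_numElt q_star_gt /=.
apply: (@le_lt_trans _ _ (q x)); first by apply: ereal_inf_lbound; exists x.
by rewrite ltey_eq q_obj_fin_num.
Qed.

Lemma q_star_le x : U x -> fine (q_star r Ys g Phi) <= fine (q x).
Proof.
move=> Ux; apply: fine_le; [exact: q_star_fin_num Ux|exact: q_obj_fin_num|].
by apply: ereal_inf_lbound; exists x.
Qed.

Let f_ub z y : U z -> Ys y -> Phi z y - g y <= fine (f z).
Proof. by move=> Uz Yy; rewrite -lee_fin fineK ?f_fin // f_max_ubound. Qed.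

Let f_lub z d : U z -> (forall y, Ys y -> Phi z y - g y <= d) -> fine (f z) <= d.
Proof.
move=> Uz hd; rewrite -lee_fin fineK ?f_fin //.
by apply: ge_ereal_sup => _ [y Yy <-]; rewrite lee_fin hd.
Qed.

Lemma f_max_weakly_convex : convex_mod U (fine \o f) (- gamma).
Proof.
apply: (@convex_mod_sup _ _ _ Ys (fun y z => Phi z y - g y)) => // y Yy.
have cPhi : convex_mod U (Phi ^~ y) (- gamma).
  apply: convex_mod_of_gradient => //; first by move=> x Ux; exact: Phi_diff.
  by move=> x x' Ux Ux'; have := Phi_weakly_convex Ux Ux' Yy; lra.
by move=> x x' t Ux Ux' t01; have := cPhi x x' t Ux Ux' t01; lra.
Qed.

(** Everything is reduced to the real-valued function h on dom r, on which q and
    the Bregman distance are finite; off dom r the extended objective is +oo, so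
    its minimizers are those of h.  Uniqueness is the quadratic growth. *)
Lemma prox_growth lam x : 0 < lam < gamma^-1 -> 0 < gamma -> U x ->
  let h z := fine (q z) + lam^-1 * fine (bregman wX z x) in
  exists p, [/\ U p, prox q wX x lam = [set p]
    & forall z, U z -> (lam^-1 - gamma) / 2 * `|z - p| ^+ 2 <= h z - h p].
Proof.
move=> /andP[lam0 lamg] gamma0 Ux h.
have il0 : 0 < lam^-1 by rewrite invr_gt0.
have mu0 : 0 < lam^-1 - gamma.
  by rewrite subr_gt0 -(invrK gamma) ltf_pV2 // posrE invr_gt0.
pose b z := lam^-1 * (fine (wX z) + (- fine (wX x) - egrad wX x (z - x))).
have hE z : U z -> h z = fine (f z) + fine (r z) + b z.
  by move=> Uz; rewrite /h fine_q_objE // (fine_bregmanE wX_dgf wX_int).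
have hconv : convex_mod U h (lam^-1 - gamma).
  move=> z z' t Uz Uz' t01; rewrite !hE //; last exact: U_convex.
  rewrite /b -!(fine_bregmanE wX_dgf wX_int) //; last exact: U_convex.
  have := f_max_weakly_convex Uz Uz' t01.
  have := econvex_fine r_proper r_convex Uz Uz' t01.
  have := convex_modZ (ltW il0)
    (bregman_convex_mod wX_dgf wX_int U_convex Ux) Uz Uz' t01.
  by rewrite /=; lra.
have hlb z : U z -> fine (q_star r Ys g Phi) <= h z.
  move=> Uz; apply: (le_trans (q_star_le Uz)); rewrite lerDl mulr_ge0 ?(ltW il0) //.
  apply: le_trans (bregman_ge wX_dgf wX_int U_convex Uz Ux).
  by rewrite mulr_ge0 ?invr_ge0 // exprn_ge0.
have hcl c : closed [set z | U z /\ h z <= c].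
  have -> : [set z | U z /\ h z <= c] =
      [set z | U z /\ fine (f z) + fine (r z) + b z <= c].
    by apply/seteqP; split => z [Uz hz]; split => //; rewrite ?hE // -hE.
  apply: (@composite_sublevel_closed _ _ _ Ys (fun y z => Phi z y - g y)) => //.
    move=> z y Uz Yy; apply: cvgB; last exact: cvg_cst.
    by apply: (@differentiable_continuous _ _ _ _ (Phi ^~ y)); exact: Phi_diff.
  move=> z Uz; apply: (@cvgMl_tmp _ _ _ _
    (fun z => fine (wX z) + (- fine (wX x) - egrad wX x (z - x)))).
  exact: (bregman_continuous wX_dgf wX_int).
have [p Up pmin] := convex_mod_has_min mu0 U_convex hconv (ex_intro _ x Ux) hlb hcl.
have growth z : U z -> (lam^-1 - gamma) / 2 * `|z - p| ^+ 2 <= h z - h p.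
  exact: (convex_mod_growth mu0 U_convex hconv).
exists p; split => //.
have QE z : U z -> (q z + lam^-1%:E * bregman wX z x)%E = (h z)%:E.
  move=> Uz; rewrite /h EFinD EFinM !fineK ?q_obj_fin_num //.
  exact: (bregman_fin_num wX_dgf wX_int).
have Qoff z : ~ U z -> (q z + lam^-1%:E * bregman wX z x)%E = +oo%E.
  move=> nUz; rewrite q_obj_off // addye //.
  have := bregman_neqNy wX_dgf wX_int z Ux; case: (bregman wX z x) => [s| |] // _.
  by rewrite gt0_muley ?lte_fin.
apply/seteqP; split => [z zmin|_ ->].
  have Uz : U z.
    apply: contrapT => nUz; have := zmin x.
    by rewrite Qoff // QE // leye_eq.
  have := zmin p; rewrite !QE // lee_fin => hz.
  have gz := growth z Uz.
  have : (lam^-1 - gamma) / 2 * `|z - p| ^+ 2 <= 0 by lra.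
  rewrite pmulr_rle0 ?divr_gt0 // => N0.
  have /eqP : `|z - p| ^+ 2 = 0 by apply: le_anti; rewrite N0 exprn_ge0.
  by rewrite expf_eq0 /= normr_eq0 subr_eq0 => /eqP.
move=> z; have [Uz|nUz] := pselect (U z); last by rewrite [leRHS]Qoff // leey.
by rewrite !QE // lee_fin pmin.
Qed.
End Prox.

(** * Counting iterations *)

Section Descent.
Context {R : realType}.

(** The step hypothesis is only available before the first stop, as an iterate is
    only constrained while the algorithm runs; the first stop exists because a
    decrease of d per step would otherwise exhaust the gap a 1 - m. *)
Lemma descent_stops (P : nat -> Prop) (a : nat -> R) (d m : R) :
  0 < d ->
  (forall k, (1 <= k)%N -> (forall j, (1 <= j < k)%N -> ~ P j) ->
     m <= a k /\ (~ P k -> a k.+1 + d <= a k)) ->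
  exists K : nat, [/\ (1 <= K)%N, P K, forall j, (1 <= j < K)%N -> ~ P j
    & K.-1%:R * d <= a 1%N - m].
Proof.
move=> d0 step.
have drop n : (forall j, (1 <= j < n.+1)%N -> ~ P j) -> a n.+1 + n%:R * d <= a 1%N.
  elim: n => [|n IH] nP; first by rewrite mul0r addr0.
  have nP' j : (1 <= j < n.+1)%N -> ~ P j.
    by case/andP=> j1 jn; apply: nP; rewrite j1 ltnS ltnW.
  have [_ /(_ (nP n.+1 _))] := step n.+1 isT nP'.
  rewrite ltnS leqnn => /(_ isT); have := IH nP'.
  rewrite -[in n.+1%:R]addn1 natrD; lra.
have bound n : (forall j, (1 <= j < n.+1)%N -> ~ P j) -> n%:R * d <= a 1%N - m.
  by move=> nP; have [mn _] := step n.+1 isT nP; have := drop _ nP; lra.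
have [k /andP[k1 /asboolP Pk]] : exists k, (1 <= k)%N && `[< P k >].
  apply: contrapT => nex.
  have nP j : (1 <= j)%N -> ~ P j.
    by move=> j1 Pj; apply: nex; exists j; rewrite j1; exact/asboolP.
  have := bound (Num.truncn ((a 1%N - m) / d)).+1 (fun j h => nP j (andP h).1).
  by rewrite leNgt -ltr_pdivrMr // Num.Theory.truncnS_gt.
have ex : exists k, (1 <= k)%N && `[< P k >] by exists k; rewrite k1; exact/asboolP.
case: (ex_minnP ex) => K /andP[K1 /asboolP PK] Kmin.
have nP j : (1 <= j < K)%N -> ~ P j.
  case/andP => j1 jK Pj; move: jK; rewrite ltnNge => /negP; apply.
  by apply: Kmin; rewrite j1; exact/asboolP.
exists K; split => //; apply: bound; by rewrite prednK.
Qed.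

(** For n >= 1 the term 4 (1 - a) c is at most 4 n (1 - a) c and can be absorbed
    on the left, where a - 4 (1 - a) = 5 a - 4; for n = 0 nothing is to prove. *)
Lemma iteration_count (n : nat) (a c gap : R) :
  4 / 5 < a -> a <= 1 -> 0 < c -> 0 <= gap ->
  n%:R * (a * c) <= gap + 4 * (1 - a) * c ->
  n%:R <= gap / (c * (5 * a - 4)).
Proof.
move=> a45 a1 c0 gap0 h; have ca : 0 < c * (5 * a - 4) by apply: mulr_gt0 => //; lra.
rewrite ler_pdivlMr //.
case: n h => [|n] h; first by rewrite mul0r.
have n1 : 1 <= n.+1%:R :> R by rewrite ler1n.
move: (n.+1%:R) n1 h => N N1 h.
have : 0 <= (N - 1) * ((1 - a) * c) by rewrite !mulr_ge0 ?subr_ge0 // ltW.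
lra.
Qed.

(** The accuracy eta is calibrated so that four stopping radii make up the
    distance eps * lam / beta allowed between x and its proximal point. *)
Lemma stopping_radius (gamma lam beta eps : R) :
  0 < lam -> lam < gamma^-1 -> 0 < gamma -> 0 < beta -> 0 < eps ->
  Num.sqrt (2 * (eps ^+ 2 * lam * (1 - gamma * lam) / (32 * beta ^+ 2)) /
    (lam^-1 - gamma)) = eps * lam / (4 * beta).
Proof.
move=> lam0 lamg gamma0 beta0 eps0.
have s0 : 0 < eps * lam / (4 * beta) by rewrite !(mulr_gt0, invr_gt0).
rewrite (_ : 2 * _ / _ = (eps * lam / (4 * beta)) ^+ 2) ?sqrtr_sqr ?gtr0_norm //.
have a1 : 0 < 1 - gamma * lam by rewrite subr_gt0 -ltr_pdivlMl // mulr1.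
have -> : lam^-1 - gamma = (1 - gamma * lam) / lam by field; rewrite gt_eqF.
by field; rewrite !gt_eqF.
Qed.
End Descent.

(** * Complexity of the smoothing framework *)

Unset Implicit Arguments.
Set Strict Implicit.

Theorem corollary4p1 (R : realType) (X Y : finNormedModType R)
    (r : X -> \bar R) (Ys : set Y) (g : Y -> R)
    (Xo : set X) (Yo : set Y) (Phi : X -> Y -> R)
    (Lxx Lxy Lyy gamma : R)
    (wX : X -> \bar R) (wY : Y -> \bar R) (betaX : R)
    (r_proper : never_ninfty r) (r_closed : eclosed r) (r_convex : econvex r)
    (domr_neq0 : edom r !=set0) (domr_closed : closed (edom r))
    (domr_convex : convex_set (edom r))
    (Ys_neq0 : Ys !=set0) (Ys_convex : convex_set Ys) (Ys_compact : compact Ys)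
    (g_convex : convex_function Ys g) (g_cont : {within Ys, continuous g})
    (Xo_open : open Xo) (Xo_sup : edom r `<=` Xo)
    (Yo_open : open Yo) (Yo_sup : Ys `<=` Yo)
    (Phi_cont : {within Xo `*` Yo, continuous (fun p : X * Y => Phi p.1 p.2)})
    (Phi_concave : forall x, edom r x ->
       convex_function Ys (fun y => - Phi x y))
    (q_star_gt : (-oo < q_star r Ys g Phi)%E)
    (Phi_smooth_x : smooth_in_x r Ys Phi Xo Lxx Lxy)
    (gamma_gt0 : 0 < gamma) (gamma_le : gamma <= Lxx)
    (Phi_weakly_convex : weakly_convex_in_x r Ys Phi gamma)
    (Phi_smooth_y : smooth_in_y r Ys Phi Yo Lxy Lyy)
    (wX_dgf : DGF (edom r) wX) (wX_C2 : C2_on (edom wX)° (fine \o wX))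
    (wX_int : edom r `<=` (edom wX)°)
    (betaX_ge1 : 1 <= betaX)
    (wX_lip : forall x x', edom r x -> edom r x' ->
       (dual_norm (egrad wX x \- egrad wX x')%R <= (betaX * `|x - x'|)%:E)%E)
    (wY_dgf : DGF Ys wY)
    (radius_gt0 : (0 < DGF_radius Ys wY)%E)
    (radius_fin : (DGF_radius Ys wY < +oo)%E)
    (lam : R) (lam_gt : 4 / 5 * gamma^-1 < lam) (lam_lt : lam < gamma^-1)
    (eps : R) (eps_gt0 : 0 < eps)
    (eta : R)
    (eta_def : eta = eps ^+ 2 * lam * (1 - gamma * lam) / (32 * betaX ^+ 2))
    (x1 : X) (x1_dom : edom r x1)
    (x : nat -> X) (x_run : pds_run r Ys g Phi wX wY gamma eta lam x1 x) :
  exists K : nat,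
    [/\ terminates_at gamma eta lam x K,
        near_stationary (edom r) (q_obj r Ys g Phi) wX gamma betaX eps (x K)
      & (K%:Z <= Num.ceil
           (32 * betaX ^+ 2
              * (fine (q_obj r Ys g Phi x1) - fine (q_star r Ys g Phi))
            / (5 * eps ^+ 2 * lam * (gamma * lam - 4 / 5))) + 1)%R].
Proof.
have [Phi_dx _ _] := Phi_smooth_x; have [Phi_dy _ _] := Phi_smooth_y.
have U_convex := econvex_line_convex r_proper r_convex.
have f_fin z : edom r z -> f_max Ys g Phi z \is a fin_num.
  move=> Uz; apply: f_max_fin_num => // y Yy; exact/Phi_dy/Yo_sup.
have Phi_diff z y : edom r z -> Ys y -> differentiable (Phi ^~ y) z.
  by move=> Uz Yy; apply: Phi_dx => //; exact: Xo_sup.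
pose M := fine (DGF_radius Ys wY).
have M0 : 0 < M by rewrite /M fine_gt0 // radius_gt0.
have beta0 : 0 < betaX by exact: lt_le_trans betaX_ge1.
have lam0 : 0 < lam by apply: lt_trans lam_gt; rewrite mulr_gt0 ?invr_gt0.
pose a := gamma * lam; pose c := eps ^+ 2 * lam / (32 * betaX ^+ 2).
have a1 : a < 1 by rewrite /a -ltr_pdivlMl // mulr1.
have a45 : 4 / 5 < a by rewrite /a -ltr_pdivrMl // mulrC.
have c0 : 0 < c by rewrite /c !(mulr_gt0, invr_gt0, exprn_gt0).
have eta_c : eta = c * (1 - a) by rewrite eta_def /c /a; field; rewrite gt_eqF.
have eta0 : 0 < eta by rewrite eta_c mulr_gt0 // subr_gt0.
pose mu := lam^-1 - gamma.
have mu_a : mu * lam = 1 - a by rewrite /mu mulrBl mulVf ?gt_eqF.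
have mu0 : 0 < mu by rewrite -(pmulr_lgt0 _ lam0) mu_a subr_gt0.
pose s := eps * lam / (4 * betaX).
have s0 : 0 < s by rewrite /s !(mulr_gt0, invr_gt0).
have s2 : s ^+ 2 = 2 * c * lam by rewrite /s /c; field; rewrite gt_eqF.
have radE : Num.sqrt (2 * eta / (lam^-1 - gamma)) = s.
  by rewrite eta_def stopping_radius.
pose rho := 2 * eta / M.
have rho0 : 0 <= rho by rewrite /rho divr_ge0 ?mulr_ge0 // ltW.
have rhoM : rho * M = 2 * eta by rewrite /rho divfK ?gt_eqF.
pose qs z := fine (q_smooth r Ys g Phi wY rho z).
pose q z := fine (q_obj r Ys g Phi z).
have qsE z : edom r z -> q_smooth r Ys g Phi wY rho z = (qs z)%:E.
  by move=> Uz; rewrite /qs fineK // q_smooth_fin_num // f_fin.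
have qs_near z : edom r z -> q z - 2 * eta <= qs z <= q z + 2 * eta.
  by move=> Uz; rewrite -rhoM; apply: q_smooth_near => //; exact: f_fin.
pose D z w := fine (bregman wX z w).
have D_ge z w : edom r z -> edom r w -> `|z - w| ^+ 2 / 2 <= D z w.
  by move=> Uz Uw; exact: (bregman_ge wX_dgf wX_int).
have [x_1 run] := x_run.
have step k : (1 <= k)%N ->
    (forall j, (1 <= j < k)%N -> ~ stops gamma eta lam x j) ->
    edom r (x k) -> edom r (x k.+1) /\ forall z, edom r z ->
      qs (x k.+1) + lam^-1 * D (x k.+1) (x k) <=
      qs z + lam^-1 * D z (x k) + eta.
  move=> k1 nstop Uk; have [Uk1 hk] := run k k1 nstop; split=> // z Uz.
  have QE w : edom r w -> Q_smooth r Ys g Phi wX wY rho lam w (x k) =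
      (qs w + lam^-1 * D w (x k))%:E.
    move=> Uw; rewrite /Q_smooth qsE // EFinD EFinM; congr (_ + _ * _)%E.
    by rewrite /D fineK // (bregman_fin_num wX_dgf wX_int).
  rewrite -lee_fin [in leRHS]EFinD -!QE //; apply: (le_trans hk).
  by rewrite leeD2r //; apply: ereal_inf_lbound; exists z.
have Ux k : (1 <= k)%N ->
    (forall j, (1 <= j < k)%N -> ~ stops gamma eta lam x j) -> edom r (x k).
  elim: k => // k IH _ nstop; have [k0|k0] := posnP k; first by rewrite k0 x_1.
  have nstop' j : (1 <= j < k)%N -> ~ stops gamma eta lam x j.
    by case/andP => j1 jk; apply: nstop; rewrite j1 ltnS ltnW.
  by have [] := step k k0 nstop' (IH k0 nstop').
have D_diag z : edom r z -> D z z = 0.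
  by move=> Uz; exact: (bregman_diag wX_dgf wX_int).
have qstar_le z : edom r z -> fine (q_star r Ys g Phi) <= q z.
  by move=> Uz; exact: q_star_le.
have ac0 : 0 < a * c by rewrite mulr_gt0 //; lra.
have descent k : (1 <= k)%N ->
    (forall j, (1 <= j < k)%N -> ~ stops gamma eta lam x j) ->
    fine (q_star r Ys g Phi) - 2 * eta <= qs (x k) /\
    (~ stops gamma eta lam x k -> qs (x k.+1) + a * c <= qs (x k)).
  move=> k1 nst; have Uk := Ux k k1 nst; split.
    by have := qs_near _ Uk; have := qstar_le _ Uk; lra.
  have [Uk1 hk] := step k k1 nst Uk.
  rewrite /stops radE => /negP; rewrite -ltNge => far.
  have far2 : s ^+ 2 < `|x k.+1 - x k| ^+ 2 by rewrite ltr_pXn2r ?nnegrE // ltW.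
  have Dc : c <= lam^-1 * D (x k.+1) (x k).
    rewrite ler_pdivlMl //; have := D_ge _ _ Uk1 Uk; lra.
  (* The comparison point in the subproblem is x k itself. *)
  by have := hk _ Uk; rewrite D_diag // mulr0 eta_c; lra.
have [K [K1 stopK nstop Kbound]] :=
  @descent_stops R _ (fun k => qs (x k)) _ _ ac0 descent.
have UK := Ux K K1 nstop; have [UK1 hK] := step K K1 nstop UK.
exists K; split => //.
- have lam_int : 0 < lam < gamma^-1 by rewrite lam0.
  have [p [Up proxE growth]] := prox_growth r_proper r_closed r_convex
    domr_closed Ys_neq0 f_fin Phi_diff Phi_weakly_convex q_star_gt wX_dgf wX_int
    lam_int gamma_gt0 UK.
  split => //; exists lam, p; split => //.
  have close : `|x K.+1 - p| ^+ 2 <= 5 * s ^+ 2.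
    (* eta from the inexact step, 2 * eta for each of the two passages between
       the smoothed and the original objective. *)
    have far5 : mu / 2 * `|x K.+1 - p| ^+ 2 <= 5 * eta.
      have := growth _ UK1; have := hK _ Up.
      have := qs_near _ UK1; have := qs_near _ Up; rewrite /D /q /mu; lra.
    by rewrite s2 -(ler_pM2l mu0); move: far5; rewrite eta_c -mu_a; lra.
  have close3 : `|x K.+1 - p| <= 3 * s.
    have s3 : 0 <= 3 * s by lra.
    rewrite -(ler_pXn2r (ltn0Sn 1)) ?nnegrE //.
    by have := sqr_ge0 s; lra.
  have : `|x K - p| <= 4 * s.
    have := ler_distD (x K.+1) (x K) p; rewrite (distrC (x K) (x K.+1)).
    move: stopK; rewrite /stops radE. lra.
  rewrite normrZ gtr0_norm ?invr_gt0 // ler_pdivrMl //.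
  by rewrite /s (_ : 4 * _ = lam * (eps / betaX)) //; field; rewrite gt_eqF.
- have gap0 := qstar_le _ x1_dom.
  have Kn : K.-1%:R <= (q x1 - fine (q_star r Ys g Phi)) / (c * (5 * a - 4)).
    apply: iteration_count => //; [exact: ltW|by rewrite subr_ge0|].
    by have := qs_near _ x1_dom; move: Kbound; rewrite x_1 eta_c; lra.
  set z := (X in Num.ceil X).
  have zE : z = (q x1 - fine (q_star r Ys g Phi)) / (c * (5 * a - 4)).
    rewrite /z /c /a /q; field.
    by apply/and4P; split; apply: lt0r_neq0 => //; move: a45; rewrite /a; lra.
  rewrite -(prednK K1) -addn1 PoszD lerD2r zE.
  by rewrite -(ler_int R) (le_trans _ (Num.Theory.ceil_ge _)).
Qed.
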